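(* Let $d\ge 1$ be an integer, let $\rho_0>0$ and $\vec\beta=(\beta_i)_{i\in\mathbb{N}}$ be admissible game parameters (as defined in the context), let $F\subseteq\mathbb{R}^d\times\omega^\omega$, and let $A=p[F]=\{x\in\mathbb{R}^d : \exists y\in\omega^\omega\ (x,y)\in F\}$. Let $0<\delta<s\le d$. If player II has a winning strategy in the unfolded $\delta$-Hausdorff dimension game for $F$ (with parameters $\rho_0,\vec\beta$), then player II has a winning strategy in the $s$-Hausdorff dimension game $G^{s}_{\vec\beta}(A)$ with target set $A$ (with the same parameters $\rho_0,\vec\beta$).
   Context: $\omega=\mathbb{N}$ and $\omega^\omega$ is the set of infinite sequences of natural numbers. $B(x,r)$ denotes the closed ball of radius $r$ centred at $x$ in $\mathbb{R}^d$ (Euclidean metric). A set is $r$-separated if any two distinct points of it are at distance at least $r$. $|E|$ is the cardinality of a finite set $E$. Admissible game parameters: a real $\rho_0>0$ and a sequence $(\beta_i)_{i\in\mathbb{N}}$ of reals with $0<\beta_{i+1}\le\beta_i<\frac12$ for all $i$, $\lim_{i\to\infty}\beta_i=0$, and $$\forall\eta>0\ \exists n_0\ \forall n\ge n_0\quad \beta_n\ge\prod_{i<n}\beta_i^{\eta}.$$ Put $\rho_n=\left(\prod_{i<n}\beta_i\right)\rho_0$. The $\delta$-Hausdorff dimension game $G^{\delta}_{\vec\beta}(A)$ ($A\subseteq\mathbb{R}^d$, $0<\delta\le d$): players I and II alternate moves $F_0,x_0,F_1,x_1,\dots$, where I plays the $F_i$ and II plays the $x_i$. Player I must follow these rules: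 (a) each $F_i$ is a finite nonempty set of points of $\mathbb{Q}^d$; (b) each $F_i$ is $3\rho_i$-separated; (c) $F_{i+1}\subseteq B(x_i,(1-\beta_i)\rho_i)$ for all $i$; (d) there is some $c>0$ such that $\displaystyle\limsup_{n\to\infty}\frac{\prod_{i<n}|F_i|^{-1}}{\prod_{i<n}\beta_i^{\delta}}\le c$. Player II must play $x_i\in F_i$ for every $i$. A player who violates these requirements loses (the first to violate (a), (b), (c) or II's requirement loses; if only (d) is violated, I loses). If the players meet these requirements, player I wins if and only if $\lim_{n\to\infty}x_n\in A$; otherwise II wins. The unfolded $\delta$-Hausdorff dimension game for $F\subseteq\mathbb{R}^d\times\omega^\omega$ (with target set $A=p[F]$), $0<\delta\le d$: in each round $i$ player I plays a set $F_i$ and, in the same move, if I so chooses, also a digit in $\omega$, which becomes the next digit $y_j$ extending the finite sequence $y_0,\dots,y_{j-1}$ of digits played so far (at most one digit per round); player II then plays $x_i\in F_i$. Player I must satisfy rules (a)–(d) of the $\delta$-Hausdorff dimension game and, in addition, (e) for every $j\in\omega$ the digit $y_j$ is eventually played. A player who violates these requirements loses (the first to violate (a), (b), (c) or II's requirement $x_i\in F_i$ loses; if none of these is violated but (d) or (e) is violated, I loses). If all requirements are met, player I wins if and only if $(x,y)\in F$, where $x=\lim_{n\to\infty}x_n$ and $y=(y_0,y_1,\dots)$; otherwise II wins. *)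

(* Defs.v *)
From mathcomp Require Import all_boot all_order all_algebra finmap.
From mathcomp Require Import all_classical all_reals all_analysis.

Set Implicit Arguments.
Unset Strict Implicit.
Unset Printing Implicit Defensive.

Import Order.TTheory GRing.Theory Num.Theory numFieldNormedType.Exports.

Local Open Scope classical_set_scope.
Local Open Scope ring_scope.

(** Infinite two-player games, the players moving alternately and I first.
    A run is a pair of sequences [a] (moves of I) and [b] (moves of II). *)

Section Strategies.
Variables MI MII : Type.

(* The first argument is the list of completed rounds, the second one is the
   move just made by I. *)
Definition II_strategy := seq (MI * MII) -> MI -> MII.

Definition follows (tau : II_strategy) (a : nat -> MI) (b : nat -> MII) :=
  forall n, b n = tau (mkseq (fun i => (a i, b i)) n) (a n).

Definition II_has_winning_strategy
    (II_wins : (nat -> MI) -> (nat -> MII) -> Prop) :=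
  exists tau : II_strategy, forall a b, follows tau a b -> II_wins a b.

End Strategies.

Section Game.
Variables (R : realType) (d : nat).

(* The library norm on matrices is the sup norm, hence this definition. *)
Definition enorm (v : 'rV[R]_d) : R := Num.sqrt (\sum_(i < d) v 0 i ^+ 2).

Definition eball (x : 'rV[R]_d) (r : R) : set 'rV[R]_d :=
  [set y | enorm (y - x) <= r].

Definition r_separated (r : R) (E : set 'rV[R]_d) :=
  forall p q, E p -> E q -> p <> q -> r <= enorm (p - q).

Definition rational_point : set 'rV[R]_d :=
  [set p | exists q : 'rV[rat]_d, p = map_mx ratr q].

Variables (rho0 : R) (beta : nat -> R).

Definition admissible :=
  [/\ 0 < rho0,
      forall i, [/\ 0 < beta i.+1, beta i.+1 <= beta i & beta i < 2^-1],
      beta @ \oo --> (0 : R) &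
      forall eta : R, 0 < eta ->
        exists n0, forall n, (n0 <= n)%N ->
          \prod_(i < n) (beta i `^ eta) <= beta n].

Definition rho (n : nat) : R := (\prod_(i < n) beta i) * rho0.

Section Rules.
Variables (E : nat -> {fset 'rV[R]_d}) (x : nat -> 'rV[R]_d).

Definition rule_a (n : nat) :=
  [set` E n] !=set0 /\ [set` E n] `<=` rational_point.

Definition rule_b (n : nat) := r_separated (3 * rho n) [set` E n].

(* Constraint on the [n]-th move of I; the initial move is unconstrained. *)
Definition rule_c (n : nat) :=
  if n is m.+1 then [set` E m.+1] `<=` eball (x m) ((1 - beta m) * rho m)
  else True.

Definition I_legal (n : nat) := [/\ rule_a n, rule_b n & rule_c n].

Definition II_legal (n : nat) := x n \in E n.

Definition rule_d (delta : R) :=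
  exists2 c : R, 0 < c &
    (limn_esup (fun n =>
       ((\prod_(i < n) (#|` E i|%:R)^-1) /
        (\prod_(i < n) (beta i `^ delta)))%:E) <= c%:E)%E.

Definition I_first_to_violate :=
  exists2 n, (forall i, (i < n)%N -> I_legal i /\ II_legal i) & ~ I_legal n.

Definition all_legal := forall n, I_legal n /\ II_legal n.

End Rules.

Definition II_wins_game (delta : R) (A : set 'rV[R]_d)
    (E : nat -> {fset 'rV[R]_d}) (x : nat -> 'rV[R]_d) :=
  I_first_to_violate E x \/
  (all_legal E x /\ (~ rule_d E delta \/ ~ A (limn x))).

(** Unfolded game: a move of I is a finite set together with an optional
    digit. *)

Definition digits_played (e : nat -> option nat) (n : nat) : seq nat :=
  pmap e (iota 0 n).

Definition rule_e (e : nat -> option nat) :=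
  forall j, exists n, (j < size (digits_played e n))%N.

(* Under [rule_e] there is exactly one such [y]. *)
Definition digit_sequence (e : nat -> option nat) (y : nat -> nat) :=
  forall j n, (j < size (digits_played e n))%N ->
    y j = nth 0%N (digits_played e n) j.

Definition II_wins_unfolded_game (delta : R)
    (F : set ('rV[R]_d * (nat -> nat)))
    (a : nat -> {fset 'rV[R]_d} * option nat) (x : nat -> 'rV[R]_d) :=
  let E i := (a i).1 in
  let e i := (a i).2 in
  I_first_to_violate E x \/
  (all_legal E x /\
   [\/ ~ rule_d E delta, ~ rule_e e |
       ~ exists2 y, digit_sequence e y & F (limn x, y)]).

End Game.

Definition proj_set (R : realType) (d : nat)
    (F : set ('rV[R]_d * (nat -> nat))) : set 'rV[R]_d :=
  [set x | exists y, F (x, y)].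

(* Main.v *)
Require Import Defs.
From mathcomp Require Import all_boot all_order all_algebra finmap.
From mathcomp Require Import all_classical all_reals all_analysis.

(** II wins the plain game by secretly playing, against each possible digit
    sequence [y], a shadow run of the unfolded game in which II follows the
    given winning strategy [tau]. All shadow runs have the same points
    [x_0, x_1, ...] as the real run; in round [n] a shadow run uses a subset
    [S_n] of the set [E_n] played by I. If for each [y] the shadow run spelling
    [y] is legal and satisfies rules (d) and (e), then [tau] wins it, so
    [(lim x, y)] is not in [F]; hence [lim x] is not in the projection of [F].

    For one reply [x_n] to fit all shadow runs, only finitely many, say [K_n],
    may be distinguishable at round [n]: digits are played late, and the choice
    in round [n] is between no digit and the digits below a bound [g n]
    ([words], [schedule]). Fix one of the [K_n] shadow runs and let [U] be the
    set of the points of [E_n] that [tau] never chooses when offered a subset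
    of [E_n] of at least [#|E_n| / K_n] points. Then [K_n * #|U| < #|E_n|],
    since otherwise [tau] would answer the offer [U] by a point of [U]. The
    [K_n] sets [U] therefore do not exhaust [E_n], and any remaining point is a
    suitable [x_n] ([exists_common_point], [common_replies_nonempty]).

    The price is a factor [K_n] in the number of points at round [n]. As
    [beta_n] tends to 0 and [delta < s], the bounds [g n] can be chosen with
    [K_n <= beta_n ^ (delta - s)] and still unbounded on every tail, so that
    every digit finds its turn ([exists_digit_bound]). Then
    [#|S_n| * beta_n ^ delta >= #|E_n| * beta_n ^ s] in every round, and rule
    (d) for [s] in the real run gives rule (d) for [delta] in the shadow runs
    ([rule_d_shrink]). *)

Local Open Scope classical_set_scope.
Local Open Scope ring_scope.

Set Implicit Arguments.
Unset Strict Implicit.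
Unset Printing Implicit Defensive.

Import Order.TTheory GRing.Theory Num.Theory numFieldNormedType.Exports.

(** * Scheduling the digits *)

Section Schedule.
Local Open Scope nat_scope.

(** A queue of tasks [0, 1, 2, ...] served in order: the value counts the tasks
    finished before time [n], and [P k n] says that task [k] can be done at
    time [n]. *)
Fixpoint counter (P : nat -> nat -> bool) (n : nat) : nat :=
  if n is m.+1 then counter P m + P (counter P m) m else 0.

Lemma counter_homo P m n : m <= n -> counter P m <= counter P n.
Proof.
move=> /subnKC <-; elim: (n - m) => [|k IH]; first by rewrite addn0.
by rewrite addnS /= (leq_trans IH) ?leq_addr.
Qed.

(** No task blocks the queue: while task [k] waits the counter stands at [k],
    and a time at which task [k] is possible comes again. *)
Lemma counter_hits (P : nat -> nat -> bool) :
  (forall k N, exists2 n, N <= n & P k n) ->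
  forall k, exists2 n, counter P n = k & P k n.
Proof.
move=> Pinf.
have first k N : counter P N = k -> exists2 n, counter P n = k & P k n.
  move=> cN; have [m + Pm] := Pinf k N.
  move=> /subnKC mE; move: Pm; rewrite -{}mE.
  move: (m - N) => i; elim: i N cN => [|i IH] N cN.
    by rewrite addn0; exists N.
  have [PN _|PN] := boolP (P k N); first by exists N.
  by rewrite addnS -addSn; apply: IH; rewrite /= cN (negbTE PN) addn0.
elim=> [|k [n cn Pn]]; first exact: (first 0 0).
by apply: (first _ n.+1); rewrite /= cn Pn addn1.
Qed.

(** The [k]-th positive value of [g] is [k], postponed until [M] is at least
    the factorial that the product then reaches. *)
Lemma slow_digit_bound (M : nat -> nat) :
  0 < M 0 -> {homo M : m n / m <= n} -> (forall k, exists n, k <= M n) ->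
  exists g : nat -> nat,
    (forall n, \prod_(i < n.+1) (g i).+1 <= M n) /\
    (forall j N, exists2 n, N <= n & j < g n).
Proof.
move=> M0 Mhomo Munb.
pose P k n := k.+2`! <= M n; pose c := counter P.
pose g n := if P (c n) n then (c n).+1 else 0.
have prodg n : \prod_(i < n) (g i).+1 = (c n).+1`!.
  elim: n => [|n IH]; first by rewrite big_ord0.
  rewrite big_ord_recr /= IH /g /c /= -/c.
  by case: (P _ _); rewrite ?addn1 ?addn0 ?muln1// mulnC -factS.
exists g; split=> [n|j N].
  rewrite prodg; elim: n => [|n IH]; rewrite /c /= -/c.
    by rewrite /P; case: ltnP => //=; rewrite ?addn1 ?addn0.
  have [Pn|_] := boolP (P _ n.+1); first by rewrite addn1.
  by rewrite addn0 (leq_trans IH) ?Mhomo.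
have Pinf k m : exists2 n, m <= n & P k n.
  have [n kn] := Munb k.+2`!; exists (maxn m n); first exact: leq_maxl.
  by rewrite /P (leq_trans kn) ?Mhomo ?leq_maxr.
have [n cn Pn] := counter_hits Pinf (maxn j (c N)).
exists n; last by rewrite /g /c cn Pn ltnS leq_maxl.
rewrite leqNgt; apply/negP => /(counter_homo P) /=.
by rewrite cn Pn addn1 -/c ltnNge leq_maxr.
Qed.

Variable g : nat -> nat.

Definition options (n : nat) : seq (option nat) :=
  None :: map Some (iota 0 (g n)).

Definition schedule (y : nat -> nat) (n : nat) : option nat :=
  let j := counter (fun j n => y j < g n) n in
  if y j < g n then Some (y j) else None.

Lemma schedule_options y n : schedule y n \in options n.
Proof.
rewrite /schedule; case: ifP => // lt_yg.
by rewrite inE map_f ?orbT// mem_iota.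
Qed.

Lemma digits_schedule y n :
  digits_played (schedule y) n = mkseq y (counter (fun j n => y j < g n) n).
Proof.
elim: n => [//|n IH].
rewrite /digits_played -addn1 iotaD pmap_cat [pmap _ (iota 0 n)]IH add0n addn1.
rewrite [pmap _ _]/= [counter _ n.+1]/= /schedule.
set c := counter _ n; case: (y c < g n); first by rewrite addn1 mkseqS -cats1.
by rewrite addn0 cats0.
Qed.

Lemma schedule_sequence y : digit_sequence (schedule y) y.
Proof.
by move=> j n; rewrite digits_schedule size_mkseq => jn; rewrite nth_mkseq.
Qed.

Lemma schedule_rule_e y :
  (forall j N, exists2 n, N <= n & j < g n) -> rule_e (schedule y).
Proof.
move=> ginf j; have [|n cn Pn] := @counter_hits (fun j n => y j < g n) _ j.
  by move=> k N; exact: ginf.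
by exists n.+1; rewrite digits_schedule size_mkseq /= cn Pn addn1.
Qed.

(** The prefixes that tell the shadow runs apart before round [n]. *)
Fixpoint words (n : nat) : seq (seq (option nat)) :=
  if n is m.+1 then [seq rcons w o | w <- words m, o <- options m]
  else [:: [::]].

Lemma mem_words n w :
  (w \in words n) <->
  (size w = n /\ forall i, i < n -> nth None w i \in options i).
Proof.
elim: n w => [|n IH] w.
  rewrite inE; split=> [/eqP -> //|[/eqP]]; by rewrite size_eq0.
split=> [/allpairsPdep[v [q [/IH[sv vP] qP ->]]]|].
  rewrite size_rcons sv; split=> // i; rewrite nth_rcons sv ltnS leq_eqVlt.
  by case/predU1P => [->|lt_in]; rewrite ?ltnn ?eqxx// lt_in vP.
case/lastP: w => [|v o]; first by case.
rewrite size_rcons => -[[sv] vP].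
apply/allpairsPdep; exists v, o; split=> //; last first.
  by have := vP n; rewrite nth_rcons sv ltnn eqxx; apply.
apply/IH; split=> // i lt_in.
by have := vP i; rewrite nth_rcons sv lt_in; apply; rewrite ltnW.
Qed.

Lemma size_words n : size (words n) = \prod_(i < n) (g i).+1.
Proof.
elim: n => [|n IH]; first by rewrite big_ord0.
by rewrite big_ord_recr [LHS]size_allpairs IH /= size_map size_iota.
Qed.

End Schedule.

(** * Avoiding several small sets *)

Section Counting.
Local Open Scope nat_scope.
Local Open Scope fset_scope.

(** The average of the cardinals of the [U i] is less than [#|E| / size L], so
    their union is too small to be [E]. *)
Lemma exists_common_point (T I : choiceType) (E : {fset T}) (L : seq I)
    (U : I -> {fset T}) :
  0 < #|` E| -> (forall i, i \in L -> size L * #|` U i| < #|` E|) ->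
  exists2 x, x \in E & forall i, i \in L -> x \notin U i.
Proof.
move=> E0 ltU; apply/not_exists2P => noX.
have subE : E `<=` \bigcup_(i <- L) U i.
  apply/fsubsetP => x xE; case: (noX x) => // /existsNP[i /not_implyP[iL]].
  by move=> /negP/negPn xU; apply/bigfcupP; exists i; rewrite ?iL.
have card_bigcup : #|` \bigcup_(i <- L) U i| <= \sum_(i <- L) #|` U i|.
  elim: {subE ltU noX} L => [|i L IH]; first by rewrite big_nil cardfs0.
  rewrite !big_cons cardfsU (leq_trans (leq_subr _ _))//.
  by rewrite leq_add2l.
have := leq_trans (fsubset_leq_card subE) card_bigcup.
apply/negP; rewrite -ltnNge.
case: (posnP (size L)) => [/size0nil ->|L0]; first by rewrite big_nil.
rewrite -(ltn_pmul2l L0) big_distrr /=.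
have : size L * (#|` E|).-1 < size L * #|` E| by rewrite ltn_pmul2l ?prednK.
apply: leq_ltn_trans.
apply: (@leq_trans (\sum_(i <- L) #|` E|.-1)).
  rewrite !big_seq; apply: leq_sum => i /ltU ltUE.
  by rewrite -ltnS prednK// (leq_ltn_trans _ ltUE)// leq_pmull.
by rewrite big_const_seq count_predT iter_addn_0 mulnC.
Qed.

End Counting.

(** * Growth of the moves *)

Lemma le_limn_esup (R : realType) (u v : nat -> \bar R) :
  (forall n, u n <= v n)%E -> (limn_esup u <= limn_esup v)%E.
Proof.
move=> le_uv; rewrite !limn_esup_lim; apply: lee_lim; [exact: is_cvg_esups..|].
apply: nearW => n; apply: ge_ereal_sup => _ [m nm <-].
by apply: le_trans (le_uv m) _; apply: ereal_sup_ubound; exists m.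
Qed.

Lemma invr_powR_unbounded (R : realType) (beta : nat -> R) (eps : R) :
  0 < eps -> (forall n, 0 < beta n) -> beta @ \oo --> (0 : R) ->
  forall k, exists n, (k <= Num.trunc ((beta n)^-1 `^ eps))%N.
Proof.
move=> eps0 beta0 cvgb k.
pose b : R := k.+1%:R `^ eps^-1.
have b0 : 0 < b by rewrite powR_gt0.
have : \forall n \near \oo, `|0 - beta n| < b^-1.
  by move/cvgrPdist_lt: cvgb; apply; rewrite invr_gt0.
case=> n _ /(_ n (leqnn n)) /=; rewrite sub0r normrN gtr0_norm// => ltb.
exists n; rewrite truncn_ge_nat ?powR_ge0//.
have -> : k%:R = (k%:R `^ eps^-1) `^ eps :> R.
  by rewrite -powRrM mulVf ?gt_eqF// powRr1.
apply: ge0_ler_powR; rewrite ?nnegrE ?powR_ge0 ?ltW ?invr_gt0//.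
rewrite (@le_lt_trans _ _ b)//; last first.
  by rewrite -ltf_pV2 ?posrE ?invr_gt0 ?invrK.
by apply: ge0_ler_powR; rewrite ?nnegrE ?invr_ge0 ?(ltW eps0)// ler_nat.
Qed.

(** Apply [slow_digit_bound] to the integer part of [beta n `^ (- eps)], which
    is nondecreasing and unbounded since [beta] decreases to 0. *)
Lemma exists_digit_bound (R : realType) (rho0 : R) (beta : nat -> R) (eps : R) :
  admissible rho0 beta -> 0 < eps ->
  exists g : nat -> nat,
    (forall n, (\prod_(i < n.+1) (g i).+1)%N%:R <= beta n `^ (- eps)) /\
    (forall j N, exists2 n, (N <= n)%N & (j < g n)%N).
Proof.
move=> [_ betaP cvgb _] eps0.
have beta0 n : 0 < beta n by have [b1 b2 _] := betaP n; apply: lt_le_trans b2.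
have beta_noninc m n : (m <= n)%N -> beta n <= beta m.
  move=> /subnKC <-; elim: (n - m)%N => [|i]; first by rewrite addn0.
  by rewrite addnS; apply: le_trans; have [_ + _] := betaP (m + i)%N.
have [|m n mn||g [gM ginf]] :=
    @slow_digit_bound (fun n => Num.trunc ((beta n)^-1 `^ eps)).
- rewrite truncn_gt0 -(powRr0 (beta 0%N)^-1) ler_powR ?(ltW eps0)//.
  rewrite invf_ge1//; have [_ _ /ltW] := betaP 0%N; move/le_trans; apply.
  by rewrite invf_le1 ?ler1n.
- apply: le_truncn; apply: ge0_ler_powR; first exact: ltW.
  + by rewrite nnegrE invr_ge0 ltW.
  + by rewrite nnegrE invr_ge0 ltW.
  + by rewrite lef_pV2 ?posrE ?beta_noninc.
- exact: invr_powR_unbounded.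
exists g; split=> // n.
have -> : beta n `^ (- eps) = (beta n)^-1 `^ eps.
  by rewrite -[(beta n)^-1]powR_inv1 ?(ltW (beta0 n))// -powRrM mulN1r.
by apply: le_trans (_ : (Num.trunc ((beta n)^-1 `^ eps))%:R <= _);
  rewrite ?ler_nat ?truncn_le ?powR_ge0.
Qed.

(** A loss of a factor [K n <= beta n `^ (- (s - delta))] in the number of
    points is made up, round by round, by passing from the exponent [s] to the
    smaller exponent [delta]. *)
Lemma rule_d_shrink (R : realType) (d : nat) (beta : nat -> R) (delta s : R)
    (K : nat -> nat) (E S : nat -> {fset 'rV[R]_d}) :
  (forall n, 0 < beta n) ->
  (forall n, (K n)%:R <= beta n `^ (- (s - delta))) ->
  (forall n, (0 < #|` S n|)%N) ->
  (forall n, (#|` E n| <= K n * #|` S n|)%N) ->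
  (forall n, (0 < #|` E n|)%N) ->
  rule_d beta E s -> rule_d beta S delta.
Proof.
move=> beta0 leK S0 leES E0 [c c0 lec]; exists c => //.
apply: le_trans lec; apply: le_limn_esup => n; rewrite lee_fin.
rewrite -!prodf_div; apply: ler_prod => i _.
rewrite divr_ge0 ?invr_ge0 ?powR_ge0 ?ler0n//=.
have -> : beta i `^ s = beta i `^ delta * beta i `^ (s - delta).
  by rewrite -powRD ?subrKC// (gt_eqF (beta0 i)) implybT.
set a := beta i `^ delta; set b := beta i `^ (s - delta).
have [a0 b0] : 0 < a /\ 0 < b by rewrite !powR_gt0.
rewrite -!invfM lef_pV2 ?posrE ?mulr_gt0 ?ltr0n//.
rewrite mulrCA [leRHS]mulrC ler_pM2l//.
apply: (@le_trans _ _ ((K i)%:R * #|` S i|%:R * b)).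
  by rewrite ler_pM2r// -natrM ler_nat.
by rewrite mulrAC ger_pMl ?ltr0n// -ler_pdivlMr// div1r -powRN.
Qed.

(** * Strategies and legal moves *)

Section Replies.
Variables (MI MII : Type) (tau : II_strategy MI MII).

Fixpoint replies (a : nat -> MI) (n : nat) : seq (MI * MII) :=
  if n is m.+1 then
    let h := replies a m in rcons h (a m, tau h (a m))
  else [::].

(** Used to bring a winning strategy to bear on an unfinished run: the partial
    run is part of a complete one that follows the strategy. *)
Lemma follows_extend (a : nat -> MI) (x : nat -> MII) (n : nat) :
  (forall i, (i < n)%N -> x i = tau (mkseq (fun j => (a j, x j)) i) (a i)) ->
  exists b, [/\ follows tau a b, forall i, (i < n)%N -> b i = x i &
    b n = tau (mkseq (fun j => (a j, x j)) n) (a n)].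
Proof.
move=> xP; pose b i := tau (replies a i) (a i).
have repliesE m : replies a m = mkseq (fun j => (a j, b j)) m.
  by elim: m => [//|m IH]; rewrite mkseqS -IH.
have repliesx m : (m <= n)%N -> replies a m = mkseq (fun j => (a j, x j)) m.
  elim: m => [//|m IH] lt_mn.
  by rewrite mkseqS [LHS]/= IH ?(ltnW lt_mn)// -xP.
exists b; split=> [m|i lt_in|]; first by rewrite /b repliesE.
  by rewrite /b repliesx ?(ltnW lt_in)// -xP.
by rewrite /b repliesx.
Qed.

End Replies.

Section Legal.
Variables (R : realType) (d : nat) (rho0 : R) (beta : nat -> R).
Local Notation point := 'rV[R]_d.

Lemma I_legal_subset (E S : nat -> {fset point}) (x : nat -> point) n :
  (S n `<=` E n)%fset -> (0 < #|` S n|)%N ->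
  I_legal rho0 beta E x n -> I_legal rho0 beta S x n.
Proof.
move=> /fsubsetP SE; rewrite cardfs_gt0 => /fset0Pn[z zS] [[_ Eq] Esep Eball].
split; first by split; [exists z | move=> p /SE; exact: Eq].
  by move=> p q /SE pE /SE qE; exact: Esep.
by case: n SE Eball {zS Eq Esep} => //= n SE Eball p /SE; exact: Eball.
Qed.

Lemma I_legal_card_gt0 (E : nat -> {fset point}) (x : nat -> point) n :
  I_legal rho0 beta E x n -> (0 < #|` E n|)%N.
Proof.
by case=> [[[z zE] _] _ _]; rewrite cardfs_gt0; apply/fset0Pn; exists z.
Qed.

Variables (delta : R) (F : set (point * (nat -> nat))).
Variable tau : II_strategy ({fset point} * option nat) point.
Hypothesis tau_wins :
  forall a b, follows tau a b -> II_wins_unfolded_game rho0 beta delta F a b.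

(** As long as I has played legally, an illegal reply would make II the first
    to violate the rules, and the run would be lost for II however I goes on. *)
Lemma winning_reply_legal (a : nat -> {fset point} * option nat)
    (x : nat -> point) (n : nat) :
  (forall i, (i < n)%N -> x i = tau (mkseq (fun j => (a j, x j)) i) (a i)) ->
  (forall i, (i <= n)%N -> I_legal rho0 beta (fun j => (a j).1) x i) ->
  tau (mkseq (fun j => (a j, x j)) n) (a n) \in (a n).1.
Proof.
move=> /follows_extend[b [fb bx <-]] legal.
have legalb i : (i <= n)%N -> I_legal rho0 beta (fun j => (a j).1) b i.
  move=> le_in; have [[Ene Eq] Esep Eball] := legal i le_in.
  split=> //; case: i le_in {Ene Eq Esep} Eball => // i lt_in /=.
  by rewrite bx.
case: (tau_wins fb) => [[m before badm]|[/(_ n)[]//]].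
have [le_mn|lt_nm] := leqP m n; first by case: badm; exact: legalb.
by have [] := before n lt_nm.
Qed.

(** * Shadow runs *)

Variable g : nat -> nat.

(** The number of prefixes of length [n.+1], that is, of shadow runs that have
    to be served at once in round [n]. *)
Definition shadows (n : nat) : nat := (\prod_(i < n.+1) (g i).+1)%N.

Definition covers (H : seq (({fset point} * option nat) * point))
    (E : {fset point}) (o : option nat) (k : nat) (x : point)
    (S : {fset point}) :=
  [/\ (S `<=` E)%fset, (#|` E| <= k * #|` S|)%N & tau H (S, o) = x].

(** The real round consists of the set [E] and the point [x]; in the shadow run
    I plays [o] and, if there is one, a subset of [E] that makes [tau] answer
    [x] and has at least the required size. The choice depends only on this
    round and on the past of the shadow run, so that shadow runs with a common
    prefix agree along it. *)
Definition shadow_step (H : seq (({fset point} * option nat) * point))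
    (q : ({fset point} * point) * option nat) :=
  let: ((E, x), o) := q in
  rcons H ((xget E (covers H E o (shadows (size H)) x), o), x).

Definition shadow (h : seq ({fset point} * point)) (w : seq (option nat)) :=
  foldl shadow_step [::] (zip h w).

Definition common_replies (h : seq ({fset point} * point)) (E : {fset point}) :
    set point :=
  [set x | x \in E /\
    forall w o, w \in words g (size h) -> o \in options g (size h) ->
      exists S, covers (shadow h w) E o (shadows (size h)) x S].

Definition common_strategy : II_strategy {fset point} point :=
  fun h E => xget 0 (common_replies h E).

Section Run.
Variables (E : nat -> {fset point}) (x : nat -> point).

Definition history (n : nat) := mkseq (fun i => (E i, x i)) n.

Definition shadow_set (e : nat -> option nat) (n : nat) : {fset point} :=
  xget (E n)
    (covers (shadow (history n) (mkseq e n)) (E n) (e n) (shadows n) (x n)).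

Lemma shadowE e n :
  shadow (history n) (mkseq e n) =
  mkseq (fun i => ((shadow_set e i, e i), x i)) n.
Proof.
elim: n => [//|n IH].
rewrite [RHS]mkseqS -IH /history /shadow !mkseqS zip_rcons ?size_mkseq//.
rewrite foldl_rcons -/(history n) -/(shadow _ _).
have sizeH : size (shadow (history n) (mkseq e n)) = n by rewrite IH size_mkseq.
by rewrite /shadow_step sizeH.
Qed.

Lemma shadow_reply_legal e n (V : {fset point}) :
  (forall i, (i <= n)%N -> I_legal rho0 beta E x i) ->
  (forall i, (i < n)%N -> covers (shadow (history i) (mkseq e i))
     (E i) (e i) (shadows i) (x i) (shadow_set e i)) ->
  (V `<=` E n)%fset -> (0 < #|` V|)%N ->
  tau (shadow (history n) (mkseq e n)) (V, e n) \in V.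
Proof.
move=> legal cov VE V0.
pose a i := (if (i < n)%N then shadow_set e i else V, e i).
have aE i : (i < n)%N -> a i = (shadow_set e i, e i) by rewrite /a => ->.
have an : a n = (V, e n) by rewrite /a ltnn.
have HE i : (i <= n)%N ->
    shadow (history i) (mkseq e i) = mkseq (fun j => (a j, x j)) i.
  move=> le_in; rewrite shadowE; apply/eq_in_map => j.
  by rewrite mem_iota /= add0n => lt_ji; rewrite aE ?(leq_trans lt_ji le_in).
suff : tau (mkseq (fun j => (a j, x j)) n) (a n) \in (a n).1 by rewrite an HE.
apply: winning_reply_legal => i.
  by move=> lt_in; have [_ _ <-] := cov i lt_in; rewrite HE ?aE// ltnW.
move=> le_in; apply: (@I_legal_subset E _ x) => //; last exact: legal.
  move: le_in; rewrite leq_eqVlt => /predU1P[->|lt_in]; first by rewrite an.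
  by rewrite aE//; have [] := cov i lt_in.
move: (le_in); rewrite leq_eqVlt => /predU1P[->|lt_in]; first by rewrite an.
rewrite aE//; have [_ + _] := cov i lt_in.
move/(leq_trans (I_legal_card_gt0 (legal i le_in))).
by rewrite muln_gt0 => /andP[].
Qed.

(** The set [U p] of points that the shadow run with prefix [p] cannot reproduce
    satisfies [shadows n * #|U p| < #|E n|]: if it were larger, I could offer
    [U p] itself in that shadow run, and the reply of [tau], being legal, would
    be a reproducible point of [U p]. *)
Lemma common_replies_nonempty n :
  (forall i, (i <= n)%N -> I_legal rho0 beta E x i) ->
  (forall e i, (i < n)%N -> (forall j, (j <= i)%N -> e j \in options g j) ->
     covers (shadow (history i) (mkseq e i))
       (E i) (e i) (shadows i) (x i) (shadow_set e i)) ->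
  exists z, common_replies (history n) (E n) z.
Proof.
move=> legal cov; have E0 := I_legal_card_gt0 (legal n (leqnn n)).
pose L := [seq (w, o) | w <- words g n, o <- options g n].
have sizeL : size L = shadows n.
  rewrite size_allpairs size_words /= size_map size_iota.
  by rewrite /shadows big_ord_recr.
pose U p := [fset z in E n | `[< ~ exists S,
  covers (shadow (history n) p.1) (E n) p.2 (shadows n) z S >]]%fset.
have [//|p /allpairsP[[w o] /= [wP oP ->]]|z zE zP] :=
    @exists_common_point _ _ (E n) L U.
- rewrite ltnNge sizeL; apply/negP => leEU.
  have VE : (U (w, o) `<=` E n)%fset by exact: fset_sub.
  have V0 : (0 < #|` U (w, o)|)%N.
    by move: (leq_trans E0 leEU); rewrite muln_gt0 => /andP[].
  have [sw wopt] := (mem_words g n w).1 wP.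
  (* [w] followed by [o], as a function; its values from [n.+1] on are
     immaterial. *)
  pose e i := if (i < n)%N then nth None w i else o.
  have eP i : (i <= n)%N -> e i \in options g i.
    by rewrite /e leq_eqVlt => /predU1P[->|lt_in]; rewrite ?ltnn// lt_in wopt.
  have wE : w = mkseq e n.
    rewrite -[w in LHS](mkseq_nth None) sw.
    by apply/eq_in_map => i; rewrite mem_iota /e /= => ->.
  have := @shadow_reply_legal e n (U (w, o)) legal _ VE V0.
  have en : e n = o by rewrite /e ltnn.
  rewrite -wE en => reply.
  have : tau (shadow (history n) w) (U (w, o), o) \in U (w, o).
    apply: reply => i lt_in; apply: cov => // j le_ji.
    by apply: eP; exact: ltnW (leq_ltn_trans le_ji lt_in).
  rewrite {2}/U !inE /= => /andP[_ /asboolP]; apply.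
  by exists (U (w, o)); split.
exists z; rewrite /common_replies /= size_mkseq; split=> // w o wP oP.
apply: contrapT => noS.
have /zP : (w, o) \in L by apply/allpairsP; exists (w, o).
by rewrite !inE /= zE /= => /negP; apply; apply/asboolP.
Qed.

(** The induction carries both parts together: that the reply in round [n] can
    be reproduced needs the shadow runs to be correct in all earlier rounds. *)
Lemma common_strategy_shadows :
  follows common_strategy E x ->
  forall n, (forall i, (i <= n)%N -> I_legal rho0 beta E x i) ->
  x n \in E n /\
  forall e, (forall i, (i <= n)%N -> e i \in options g i) ->
    covers (shadow (history n) (mkseq e n)) (E n) (e n) (shadows n) (x n)
      (shadow_set e n).
Proof.
move=> foll; elim/ltn_ind => n IH legal.
have : common_replies (history n) (E n) (x n).
  rewrite foll; apply: xgetPex; apply: common_replies_nonempty => //.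
  move=> e i lt_in; apply: (IH i lt_in _).2 => j le_ji.
  by apply: legal; exact: ltnW (leq_ltn_trans le_ji lt_in).
rewrite /common_replies /= size_mkseq => -[xE xP]; split=> // e eP.
apply: xgetPex; apply: xP; last exact: eP.
apply/mem_words; rewrite size_mkseq; split=> // i lt_in.
by rewrite nth_mkseq// eP// ltnW.
Qed.

End Run.
End Legal.

Theorem theorem4 (R : realType) (d : nat) (hd : (1 <= d)%N)
    (rho0 : R) (beta : nat -> R) (hadm : admissible rho0 beta)
    (F : set ('rV[R]_d * (nat -> nat)))
    (delta s : R) (hdelta : 0 < delta) (hds : delta < s) (hs : s <= d%:R)
    (hII : II_has_winning_strategy
             (II_wins_unfolded_game rho0 beta delta F)) :
  II_has_winning_strategy (II_wins_game rho0 beta s (proj_set F)).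
Proof.
have [tau tau_wins] := hII.
have [|g [gK ginf]] := exists_digit_bound (eps := s - delta) hadm.
  by rewrite subr_gt0.
exists (common_strategy tau g) => E x foll.
have tracked := common_strategy_shadows tau_wins foll.
have [legal|] := pselect (forall n, I_legal rho0 beta E x n); last first.
  move=> illegal; left.
  have exbad : exists n, `[< ~ I_legal rho0 beta E x n >].
    by have /existsNP[n bad] := illegal; exists n; apply/asboolP.
  case: (ex_minnP exbad) => n /asboolP bad n_min; exists n => // i lt_in.
  have legal j : (j <= i)%N -> I_legal rho0 beta E x j.
    move=> le_ji; apply: contrapT => badj.
    have /n_min : `[< ~ I_legal rho0 beta E x j >] by apply/asboolP.
    by rewrite leqNgt (leq_ltn_trans le_ji lt_in).
  by split; [exact: legal | have [] := tracked i legal].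
right; split=> [n|].
  by split=> //; have [] := tracked n (fun i _ => legal i).
apply/not_andP => -[Ed [y Fxy]].
pose e := schedule g y; pose S := shadow_set tau g E x e.
have cov n : covers tau (shadow tau g (history E x n) (mkseq e n))
    (E n) (e n) (shadows g n) (x n) (S n).
  apply: (tracked n (fun i _ => legal i)).2 => i _.
  exact: schedule_options.
have S0 n : (0 < #|` S n|)%N.
  have [_ + _] := cov n; move/(leq_trans (I_legal_card_gt0 (legal n))).
  by rewrite muln_gt0 => /andP[].
have Slegal n : I_legal rho0 beta S x n.
  by apply: (@I_legal_subset _ _ _ _ E _ x) => //; have [] := cov n.
have foll_S : follows tau (fun i => (S i, e i)) x.
  by move=> n; have [_ _ <-] := cov n; rewrite shadowE.
have [[n _ //]|[_ []]] := tau_wins _ _ foll_S.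
- apply; apply: rule_d_shrink Ed => //.
  + have [_ betaP _ _] := hadm => n.
    by have [b1 b2 _] := betaP n; apply: lt_le_trans b2.
  + exact: gK.
  + by move=> n; have [] := cov n.
  + by move=> n; exact: I_legal_card_gt0 (legal n).
- by apply; exact: schedule_rule_e.
- by apply; exists y => //; exact: schedule_sequence.
Qed.
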